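(* Let $k$ be a positive integer and let $\{a_n\}_{n\geq k}$ be a sequence of positive real numbers. If $\{a_n\}_{n\geq k}$ is ratio log-concave and \[\frac{\sqrt[k+1]{a_{k+1}}}{\sqrt[k]{a_k}}> \frac{\sqrt[k+2]{a_{k+2}}}{\sqrt[k+1]{a_{k+1}}},\] then the sequence $\{\sqrt[n]{a_n}\}_{n\geq k}$ is strictly log-concave.
   Context: A sequence $(x_n)_{n\ge m}$ of positive reals is log-concave if $x_n^2\ge x_{n-1}x_{n+1}$ for all $n\ge m+1$, strictly log-concave if the inequality is strict. A sequence $(a_n)_{n\ge m}$ of positive reals is ratio log-concave if the sequence $(a_{n+1}/a_n)_{n\ge m}$ is log-concave. *)

(* Defs.v *)
From Stdlib Require Import Reals.
Open Scope R_scope.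

(* A sequence (x_n)_{n >= m} is represented by a total function nat -> R whose
   values below m are never read.  Positivity of the terms is a separate
   predicate. *)

Definition positive_from (m : nat) (x : nat -> R) : Prop :=
  forall n : nat, (m <= n)%nat -> 0 < x n.

Definition log_concave_from (m : nat) (x : nat -> R) : Prop :=
  forall n : nat, (m + 1 <= n)%nat -> x n ^ 2 >= x (n - 1)%nat * x (n + 1)%nat.

Definition strictly_log_concave_from (m : nat) (x : nat -> R) : Prop :=
  forall n : nat, (m + 1 <= n)%nat -> x n ^ 2 > x (n - 1)%nat * x (n + 1)%nat.

Definition ratio_log_concave_from (m : nat) (a : nat -> R) : Prop :=
  log_concave_from m (fun n : nat => a (n + 1)%nat / a n).

(* The positive n-th root of x; only meaningful for 0 < n and 0 < x, since
   Rpower x y is exp (y * ln x). *)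
Definition nth_root (n : nat) (x : R) : R := Rpower x (/ INR n).

Lemma nth_root_pos (n : nat) (x : R) : 0 < nth_root n x.
Proof. apply exp_pos. Qed.

Lemma nth_root_pow (n : nat) (x : R) :
  (0 < n)%nat -> 0 < x -> nth_root n x ^ n = x.
Proof.
  intros hn hx.
  rewrite <- Rpower_pow by apply nth_root_pos.
  unfold nth_root; rewrite Rpower_mult, Rinv_l.
  - now apply Rpower_1.
  - now apply not_0_INR, Nat.neq_0_lt_0.
Qed.

(* Main.v *)
Require Import Defs.
From Stdlib Require Import Reals Lra Lia.
Open Scope R_scope.

(** Put [c n = ln (a n) / n] and let [E n = c (n+2) - 2 c (n+1) + c n], so that
    strict log-concavity of the roots at [n+1] means [E n < 0].  Ratio
    log-concavity says that the third difference of [n c n] is nonpositive, and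
    this third difference is exactly [(n+3) E (n+1) - n E n].  Hence [E n < 0]
    implies [E (n+1) < 0] whenever [n >= 1], and the hypothesis on the first
    three roots starts the induction. *)

Definition second_diff (c : nat -> R) (n : nat) : R :=
  c (S (S n)) - 2 * c (S n) + c n.

(** Discrete Leibniz rule: [m] has first difference 1 and no higher ones, so the third difference of
    [m * c m] is [n] times that of [c], plus [3 * second_diff c (S n)]. *)
Lemma third_diff_nat_mul (c : nat -> R) (n : nat) :
  let b m := INR m * c m in
  b (S (S (S n))) - 3 * b (S (S n)) + 3 * b (S n) - b n
  = (INR n + 3) * second_diff c (S n) - INR n * second_diff c n.
Proof. cbv zeta; unfold second_diff; rewrite !S_INR; ring. Qed.

Lemma ln_le_iff (x y : R) : 0 < x -> 0 < y -> x <= y <-> ln x <= ln y.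
Proof.
  intros hx hy; split; intros h.
  - destruct h as [h| ->]; [left; now apply ln_increasing|right; reflexivity].
  - destruct (Rle_lt_dec x y) as [|h']; [assumption|].
    pose proof (ln_increasing y x hy h'); lra.
Qed.

Lemma ln_sqr (x : R) : 0 < x -> ln (x ^ 2) = 2 * ln x.
Proof. intros hx; rewrite ln_pow by assumption; simpl; ring. Qed.

Lemma ln_div (x y : R) : 0 < x -> 0 < y -> ln (x / y) = ln x - ln y.
Proof.
  intros hx hy; unfold Rdiv.
  rewrite ln_mult, ln_Rinv by auto using Rinv_0_lt_compat; ring.
Qed.

Lemma ln_nth_root (n : nat) (x : R) : ln (nth_root n x) = ln x / INR n.
Proof.
  unfold nth_root, Rpower; rewrite ln_exp; unfold Rdiv; apply Rmult_comm.
Qed.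

Lemma nth_root_log_concave_iff (a : nat -> R) (n : nat) :
  nth_root (S n) (a (S n)) ^ 2
    > nth_root n (a n) * nth_root (S (S n)) (a (S (S n)))
  <-> second_diff (fun m => ln (a m) / INR m) n < 0.
Proof.
  pose proof (nth_root_pos n (a n)) as p0.
  pose proof (nth_root_pos (S n) (a (S n))) as p1.
  pose proof (nth_root_pos (S (S n)) (a (S (S n)))) as p2.
  (* The equivalence is set up for the reverse, non-strict inequality; both directions then follow
     by contraposition. *)
  pose proof (ln_le_iff _ _ (pow_lt _ 2 p1) (Rmult_lt_0_compat _ _ p0 p2)) as h.
  rewrite ln_sqr, ln_mult, !ln_nth_root in h by assumption.
  unfold second_diff; split; intros h'.
  - apply Rnot_le_lt; intros h0; apply (Rlt_not_le _ _ h'), h; lra.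
  - apply Rnot_le_gt; intros h0; apply h in h0; lra.
Qed.

(** Logarithms turn ratios into first differences of [ln (a m)], and log-concavity of the ratios at
    [S n] into a bound on the second difference of these. *)
Lemma ratio_log_concave_third_diff (k : nat) (a : nat -> R) (n : nat) :
  positive_from k a -> ratio_log_concave_from k a -> (k <= n)%nat ->
  ln (a (S (S (S n)))) - 3 * ln (a (S (S n))) + 3 * ln (a (S n)) - ln (a n) <= 0.
Proof.
  intros ha hr hn.
  assert (h := hr (S n) ltac:(lia)); cbv beta in h.
  replace (S n - 1)%nat with n in h by lia.
  rewrite !Nat.add_1_r in h.
  pose proof (ha n ltac:(lia)) as p0.
  pose proof (ha (S n) ltac:(lia)) as p1.
  pose proof (ha (S (S n)) ltac:(lia)) as p2.
  pose proof (ha (S (S (S n))) ltac:(lia)) as p3.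
  apply Rge_le, ln_le_iff in h;
    [|auto using pow_lt, Rmult_lt_0_compat, Rdiv_lt_0_compat ..].
  rewrite ln_sqr, ln_mult, !ln_div in h by (auto using Rdiv_lt_0_compat).
  lra.
Qed.

Lemma second_diff_neg_step (a : nat -> R) (n : nat) :
  (0 < n)%nat ->
  ln (a (S (S (S n)))) - 3 * ln (a (S (S n))) + 3 * ln (a (S n)) - ln (a n) <= 0 ->
  second_diff (fun m => ln (a m) / INR m) n < 0 ->
  second_diff (fun m => ln (a m) / INR m) (S n) < 0.
Proof.
  intros hn h3 h.
  assert (hb : forall m, (0 < m)%nat -> ln (a m) = INR m * (ln (a m) / INR m)).
  { intros m hm; field; apply not_0_INR; lia. }
  rewrite (hb n), (hb (S n)), (hb (S (S n))), (hb (S (S (S n)))) in h3 by lia.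
  pose proof (third_diff_nat_mul (fun m => ln (a m) / INR m) n) as e.
  cbv beta zeta in e; rewrite e in h3.
  pose proof (lt_0_INR n hn) as p.
  (* Here [(n + 3) * E (n + 1) <= n * E n], whose right side is negative because [0 < n]. *)
  nra.
Qed.

Theorem theorem3p1 (k : nat) (a : nat -> R)
  (hk : (0 < k)%nat)
  (ha : positive_from k a)
  (hrlc : ratio_log_concave_from k a)
  (hinit : nth_root (k + 1) (a (k + 1)%nat) / nth_root k (a k)
           > nth_root (k + 2) (a (k + 2)%nat) / nth_root (k + 1) (a (k + 1)%nat)) :
  strictly_log_concave_from k (fun n : nat => nth_root n (a n)).
Proof.
  assert (hE : forall n, (k <= n)%nat ->
    second_diff (fun m => ln (a m) / INR m) n < 0).
  { intros n hn; induction hn as [|n hn IH].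
    - replace (k + 2)%nat with (S (S k)) in hinit by lia.
      rewrite Nat.add_1_r in hinit.
      (* In logarithms, [hinit] reads [c (k + 2) - c (k + 1) < c (k + 1) - c k], that is,
         [E k < 0]. *)
      apply ln_increasing in hinit;
        [|apply Rdiv_lt_0_compat; apply nth_root_pos].
      rewrite !ln_div, !ln_nth_root in hinit by apply nth_root_pos.
      unfold second_diff; lra.
    - apply second_diff_neg_step; [lia| |assumption].
      now apply (ratio_log_concave_third_diff k). }
  intros n hn.
  (* Concavity centred at [S n] is the sign of [E n], so the index drops by one. *)
  destruct n as [|n]; [lia|].
  replace (S n - 1)%nat with n by lia.
  rewrite Nat.add_1_r.
  apply nth_root_log_concave_iff, hE; lia.
Qed.
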